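(* Let $\mu_1,\mu_2\in\mathbb C\setminus\{0\}$. (1) ($n=2$) The variety $D_{2,1}(\mu_1,\mu_2)$ is isomorphic to the deformation of the $D_2$-singularity, i.e. to the affine surface in $\mathbb C^3$ with coordinates $(a,c,x)$ given by $$a^2-xc^2+\tfrac14x+(\mu_1^2-\mu_2^2)c-\tfrac12(\mu_1^2+\mu_2^2)=0.$$ (2) ($n=3$) The variety $D_{1,1}(\mu_1,\mu_2)$ is isomorphic to the Dancer deformation of the $D_1$-manifold (the double cover of the Atiyah–Hitchin manifold), i.e. to the affine surface in $\mathbb C^3$ with coordinates $(x,y,z)$ given by $$y^2x-z^2+\tfrac14+(\mu_1-\mu_2)y=0.$$ (3) ($n=4$) The variety $D_{0,1}(\mu_1,\mu_2)$ is isomorphic to the Atiyah–Hitchin manifold, i.e. to the affine surface in $\mathbb C^3$ with coordinates $(t,w,x)$ given by $$t^2-xw^2+w=0.$$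
   Context: $\mathcal S_n$ is the set of $n\times n$ companion matrices, i.e. complex matrices with all subdiagonal entries equal to $1$, arbitrary last column, and all other entries zero. Let $\mathcal O_i\subset\mathfrak{gl}(n,\mathbb C)$ ($i=1,2$) be the $GL(n,\mathbb C)$-orbit of semisimple matrices with eigenvalues $\mu_i,-\mu_i$ of multiplicities $k_i,l_i$, $k_i+l_i=n$, and put $d_i=k_i-l_i$. The affine variety (regular Slodowy slice to the sum of the two orbits) $\{(A,B)\in\mathcal O_1\times\mathcal O_2;\ A+B\in\mathcal S_n\}$ is denoted by $D_{2,1}(\mu_1,\mu_2)$ if $n=2$ and $d_1=d_2=0$; by $D_{1,1}(\mu_1,\mu_2)$ if $n=3$ and $d_1=d_2=1$; and by $D_{0,1}(\mu_1,\mu_2)$ if $n=4$ and $d_1=2$, $d_2=0$. *)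

(* Defs.v *)
From mathcomp Require Import all_boot all_order all_algebra.
From mathcomp Require Import classical_sets.
From mathcomp Require Import mpoly.

Set Implicit Arguments.
Unset Strict Implicit.
Unset Printing Implicit Defensive.

Import GRing.Theory.
Local Open Scope ring_scope.
Local Open Scope classical_set_scope.

Section AffineVarieties.
Variable C : fieldType.

Definition polynomial_map (m p : nat) (f : 'I_p -> {mpoly C[m]})
    (v : 'rV[C]_m) : 'rV[C]_p :=
  \row_(i < p) (f i).@[fun j => v 0 j].

(* Isomorphism of affine varieties given as sets of points X in C^m, Y in C^p:
   a regular map between Zariski closed sets is the restriction of a polynomial
   map of the ambient spaces.  If Y is Zariski closed and X, Y are related as
   below, then X = {u | f u \in Y, g (f u) = u} is Zariski closed as well, so
   closedness of X need not be required separately. *)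
Definition affine_isomorphic (m p : nat)
    (X : set 'rV[C]_m) (Y : set 'rV[C]_p) : Prop :=
  exists (f : 'I_p -> {mpoly C[m]}) (g : 'I_m -> {mpoly C[p]}),
    [/\ forall u, X u -> Y (polynomial_map f u),
        forall v, Y v -> X (polynomial_map g v),
        forall u, X u -> polynomial_map g (polynomial_map f u) = u
      & forall v, Y v -> polynomial_map f (polynomial_map g v) = v].

Definition zero_locus3 (F : C -> C -> C -> C) : set 'rV[C]_3 :=
  [set v : 'rV[C]_3 | F (v 0 0) (v 0 1) (v 0 2%:R) = 0].

End AffineVarieties.

Section SlodowySlices.
Variable C : fieldType.

(* Ones on the subdiagonal, arbitrary last column; note that the companion
   matrices of mxpoly ([companionmx]) are the transposed ones. *)
Definition companion_matrices (n : nat) : set 'M[C]_n :=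
  [set S : 'M[C]_n | forall i j : 'I_n, (j.+1 < n)%N -> S i j = (i == j.+1 :> nat)%:R].

(* Diagonal matrix with k entries mu and l = n - k entries - mu (k <= n). *)
Definition two_eigenvalue_diag (n k : nat) (mu : C) : 'M[C]_n :=
  diag_mx (\row_(i < n) if (i < k)%N then mu else - mu).

Definition semisimple_orbit (n k : nat) (mu : C) : set 'M[C]_n :=
  [set A : 'M[C]_n | exists2 P : 'M[C]_n, P \in unitmx
         & A = P *m two_eigenvalue_diag n k mu *m invmx P].

(* Pairs (A, B), with multiplicities (k1, n - k1) for A and (k2, n - k2) for B;
   thus d_i = 2 k_i - n. *)
Definition slodowy_pairs (n k1 k2 : nat) (mu1 mu2 : C) :
    set ('M[C]_n * 'M[C]_n) :=
  [set AB | [/\ semisimple_orbit k1 mu1 AB.1, semisimple_orbit k2 mu2 AB.2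
              & companion_matrices (AB.1 + AB.2)]].

(* The same variety inside the affine space C^(2 n^2) of matrix entries. *)
Definition slodowy_variety (n k1 k2 : nat) (mu1 mu2 : C) :
    set 'rV[C]_(n * n + n * n) :=
  [set row_mx (mxvec AB.1) (mxvec AB.2) | AB in slodowy_pairs k1 k2 mu1 mu2].

(* n = 2, (k1, l1) = (1, 1), (k2, l2) = (1, 1) *)
Definition D21 (mu1 mu2 : C) := slodowy_variety (n := 2) 1 1 mu1 mu2.

(* n = 3, (k1, l1) = (2, 1), (k2, l2) = (2, 1) *)
Definition D11 (mu1 mu2 : C) := slodowy_variety (n := 3) 2 2 mu1 mu2.

(* n = 4, (k1, l1) = (3, 1), (k2, l2) = (2, 2) *)
Definition D01 (mu1 mu2 : C) := slodowy_variety (n := 4) 3 2 mu1 mu2.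

End SlodowySlices.

(* Main.v *)
Require Import Defs.
From mathcomp Require Import all_boot all_order all_algebra.
From mathcomp Require Import complex.
From mathcomp Require Import classical_sets reals.
From mathcomp Require Import mpoly.
From mathcomp Require Import ring.
Import GRing.Theory.
Local Open Scope ring_scope.
Local Open Scope complex_scope.
Set Implicit Arguments.
Unset Strict Implicit.
Unset Printing Implicit Defensive.

(** Let L be the companion matrix of l^2 - x, and let h be a monic polynomial of
    degree n - 2.  Multiplication by h and reduction modulo l^2 - x are linear maps

       U : C[l]/(l^2 - x) -> C[l]/(h (l^2 - x)),
       V : C[l]/(h (l^2 - x)) -> C[l]/(l^2 - x),

    and if S is the companion matrix of h (l^2 - x), then

       S U = U L,   V S = L V,   U V = h(S),   V U = h(L).

    The three slices are obtained from h = 1, h = l - (mu1 + mu2) and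
    h = (l - mu1)^2 - mu2^2.  A pair (A, B) in the slice has A + B = S for some x,
    and A is the lift mu1 + U X V of a 2 x 2 matrix X (for n = 2, simply A = X).
    The orbit conditions become conditions on the traces of X and L X, which
    leave a matrix X with two free entries, and one equation for det X.  In the
    coordinates given by x and these entries this last equation is the equation
    of the surface.  All entries of A and B are polynomials in the three
    coordinates, and the coordinates are affine functions of entries of A and B,
    because U does not depend on x and has a left inverse.

    That a point of the surface gives a point of the slice is a computation with
    the identities above ([D21_of_surface], [D11_of_surface], [D01_of_surface]),
    as the orbit of A is described by A^2 = mu^2 and by the trace of A
    ([semisimple_orbitP]).  For the converse ([surface_of_D21],
    [surface_of_D11], [surface_of_D01]) and n > 2, the matrix mu1 - A has rank
    one, and the equations of the two orbits show that h(S), for the companion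
    matrix S = A + B, is a sum of two matrices of rank one.  A companion matrix S
    has h(S) of rank at least two, and uniqueness of factorizations through a
    plane ([rank2_factorization]) shows both that S has the form above and that
    the rank-one matrix mu1 - A is a lift. *)

(** Certificate form of an ideal membership: the difference of the two sides
    is a multiple of the difference of two sides already known to agree. *)
Lemma eq_by_multiple (C : pzRingType) (k l r l' r' : C) :
  l' = r' -> l - r = k * (l' - r') -> l = r.
Proof. by move=> ->; rewrite subrr mulr0 => /subr0_eq. Qed.

Arguments eq_by_multiple {C} k {l r l' r'}.

(** * Polynomial functions of a row vector *)

Section Regular.
Variable C : fieldType.

(** A sigma type rather than an existential, so that the polynomials of a
    finite family of regular functions can be collected without choice. *)
Definition regular m (F : 'rV[C]_m -> C) : Type :=
  {q : {mpoly C[m]} | forall u : 'rV[C]_m, q.@[fun j => u 0 j] = F u}.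

Lemma regular_const m (c : C) : regular (fun _ : 'rV_m => c).
Proof. by exists c%:MP => u; rewrite mevalC. Qed.

Lemma regular_coord m (j : 'I_m) : regular (fun u : 'rV_m => u 0 j).
Proof. by exists 'X_j => u; rewrite mevalXU. Qed.

Lemma regularD m (F G : 'rV_m -> C) :
  regular F -> regular G -> regular (fun u => F u + G u).
Proof. by move=> [p pE] [q qE]; exists (p + q) => u; rewrite mevalD pE qE. Qed.

Lemma regularN m (F : 'rV_m -> C) : regular F -> regular (fun u => - F u).
Proof. by move=> [p pE]; exists (- p) => u; rewrite mevalN pE. Qed.

Lemma regularM m (F G : 'rV_m -> C) :
  regular F -> regular G -> regular (fun u => F u * G u).
Proof. by move=> [p pE] [q qE]; exists (p * q) => u; rewrite mevalM pE qE. Qed.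

Lemma regular_sum m r (F : 'I_r -> 'rV_m -> C) :
  (forall i, regular (F i)) -> regular (fun u => \sum_i F i u).
Proof.
move=> Freg; exists (\sum_i projT1 (Freg i)) => u.
by rewrite rmorph_sum; apply: eq_bigr => i _; exact: (projT2 (Freg i)).
Qed.

Definition regular_mx m p q (M : 'rV[C]_m -> 'M[C]_(p, q)) : Type :=
  forall i j, regular (fun u => M u i j).
Lemma eq_regular m (F G : 'rV[C]_m -> C) : F =1 G -> regular F -> regular G.
Proof. by move=> FG [p pE]; exists p => u; rewrite pE FG. Qed.

Lemma regular_mxD m p q (M N : 'rV_m -> 'M[C]_(p, q)) :
  regular_mx M -> regular_mx N -> regular_mx (fun u => M u + N u).
Proof.
move=> hM hN i j; apply: eq_regular (regularD (hM i j) (hN i j)) => u.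
by rewrite mxE.
Qed.

Lemma regular_mxN m p q (M : 'rV_m -> 'M[C]_(p, q)) :
  regular_mx M -> regular_mx (fun u => - M u).
Proof.
by move=> hM i j; apply: eq_regular (regularN (hM i j)) => u; rewrite mxE.
Qed.

Lemma regular_mxM m p q r (M : 'rV_m -> 'M[C]_(p, q)) (N : 'rV_m -> 'M[C]_(q, r)) :
  regular_mx M -> regular_mx N -> regular_mx (fun u => M u *m N u).
Proof.
move=> hM hN i j.
apply: eq_regular (regular_sum (fun k => regularM (hM i k) (hN k j))) => u.
by rewrite mxE.
Qed.

Lemma regular_mx_const m p q (M : 'M[C]_(p, q)) :
  regular_mx (fun _ : 'rV[C]_m => M).
Proof. by move=> i j; apply: regular_const. Qed.

Lemma regular_lsubmx n m :
  regular_mx (fun u : 'rV[C]_(n * n + m) => vec_mx (lsubmx u) : 'M_n).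
Proof.
move=> i j; apply: eq_regular (regular_coord (lshift _ (mxvec_index i j))) => u.
by rewrite !mxE.
Qed.

Lemma regular_rsubmx n m :
  regular_mx (fun u : 'rV[C]_(m + n * n) => vec_mx (rsubmx u) : 'M_n).
Proof.
move=> i j; apply: eq_regular (regular_coord (rshift _ (mxvec_index i j))) => u.
by rewrite !mxE.
Qed.

Definition rows_mx m n (s : seq (seq C)) : 'M[C]_(m, n) :=
  \matrix_(i < m, j < n) (nth [::] s i)`_j.

Lemma regular_rows_mx m p q (s : 'rV[C]_m -> seq (seq C)) :
  (forall i j, (i < p)%N -> (j < q)%N -> regular (fun u => (nth [::] (s u) i)`_j)) ->
  regular_mx (fun u => rows_mx p q (s u)).
Proof.
move=> sreg i j; apply: eq_regular (sreg i j (ltn_ord i) (ltn_ord j)) => u.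
by rewrite mxE.
Qed.

(** Only one parametrization has to be checked to be onto: if v |-> (gA v, gB v)
    maps Y onto the slice and f is a left inverse of it, then f maps the slice
    back to Y and is also a right inverse. *)
Lemma slodowy_isomorphic n k1 k2 (mu1 mu2 : C) p (Y : set 'rV[C]_p)
    (gA gB : 'rV[C]_p -> 'M[C]_n) (f : 'M[C]_n -> 'M[C]_n -> 'rV[C]_p) :
    regular_mx gA -> regular_mx gB ->
    regular_mx (fun u => f (vec_mx (lsubmx u)) (vec_mx (rsubmx u))) ->
    (forall v, f (gA v) (gB v) = v) ->
    (forall v, Y v -> slodowy_pairs k1 k2 mu1 mu2 (gA v, gB v)) ->
    (forall A B, slodowy_pairs k1 k2 mu1 mu2 (A, B) ->
       exists2 v, Y v & A = gA v /\ B = gB v) ->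
  affine_isomorphic (slodowy_variety (n := n) k1 k2 mu1 mu2) Y.
Proof.
move=> gAreg gBreg freg fK gin gsurj.
pose g v := row_mx (mxvec (gA v)) (mxvec (gB v)).
have greg : regular_mx g.
  move=> i j; rewrite (ord1 i) /g; case: (split_ordP j) => k ->.
    case/mxvec_indexP: k => a b.
    by apply: eq_regular (gAreg a b) => u; rewrite row_mxEl mxvecE.
  case/mxvec_indexP: k => a b.
  by apply: eq_regular (gBreg a b) => u; rewrite row_mxEr mxvecE.
pose h u := f (vec_mx (lsubmx u)) (vec_mx (rsubmx u)).
have hE u : polynomial_map (fun i => projT1 (freg 0 i)) u = h u.
  by apply/rowP => i; rewrite mxE (projT2 (freg 0 i)).
have gE v : polynomial_map (fun i => projT1 (greg 0 i)) v = g v.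
  by apply/rowP => i; rewrite mxE (projT2 (greg 0 i)).
have hgK v : h (g v) = v by rewrite /h /g row_mxKl row_mxKr !mxvecK fK.
have gY u : slodowy_variety (n := n) k1 k2 mu1 mu2 u -> exists2 v, Y v & u = g v.
  by move=> [[A B] /gsurj [v Yv [-> ->]] <-]; exists v.
exists (fun i => projT1 (freg 0 i)), (fun i => projT1 (greg 0 i)).
split=> [u /gY [v Yv ->]|v Yv|u /gY [v Yv ->]|v Yv]; rewrite ?hE ?gE ?hgK //.
by exists (gA v, gB v) => //; apply: gin.
Qed.
End Regular.

(** * Equations of a semisimple orbit with two eigenvalues *)

Section Orbit.
Variable C : numFieldType.

Lemma mxtrace_pid n k : (k <= n)%N -> \tr (pid_mx k : 'M[C]_n) = k%:R.
Proof.
move=> kn; rewrite -[n](subnKC kn) pid_mx_block mxtrace_block mxtrace1.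
by rewrite raddf0 addr0.
Qed.

Lemma two_eigenvalue_diagE n k (mu : C) :
  two_eigenvalue_diag n k mu = (2 * mu) *: pid_mx k - mu%:M.
Proof.
apply/matrixP => i j; rewrite !mxE -[(i == j) in RHS](inj_eq val_inj) /=.
rewrite -(inj_eq val_inj) /=.
by case: (i =P j :> nat) => _; case: (i < k)%N => /=; ring.
Qed.

(** Write the rank factorization of E as P D Q with D = pid_mx r, and put
    M = Q P, so that E is conjugate to D M.  Idempotence says that D M D = D, so
    D M = D + nu where nu only has entries in the upper right block, and
    conjugation by the unipotent matrix 1 + nu takes D + nu to D. *)
Lemma idempotent_conj_pid n (E : 'M[C]_n) : E *m E = E ->
  exists2 P : 'M[C]_n, P \in unitmx & E = P *m pid_mx (\rank E) *m invmx P.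
Proof.
set r := \rank E => EE.
set P := col_ebase E; set Q := row_ebase E; pose D : 'M[C]_n := pid_mx r.
have Pu : P \in unitmx := col_ebase_unit E.
have Qu : Q \in unitmx := row_ebase_unit E.
have EPQ : E = P *m D *m Q by rewrite mulmx_ebase.
have DD : D *m D = D by rewrite pid_mx_id ?rank_leq_row.
pose M := Q *m P.
have DMD : D *m M *m D = D.
  move: EE; rewrite EPQ => /(congr1 (mulmx (invmx P))) /(congr1 (mulmxr (invmx Q))).
  by rewrite /= !mulmxA !mulVmx // !mul1mx -!mulmxA !mulmxV // !mulmx1 !mulmxA.
pose nu := D *m M *m (1%:M - D).
have Dnu : D *m nu = nu by rewrite /nu !mulmxA DD.
have nuD : nu *m D = 0 by rewrite /nu -mulmxA mulmxBl mul1mx DD subrr mulmx0.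
have nunu : nu *m nu = 0 by rewrite -[X in _ *m X]Dnu mulmxA nuD mul0mx.
have ZZ : (1%:M - nu) *m (1%:M + nu) = 1%:M.
  by rewrite mulmxDr mulmx1 mulmxBl mul1mx nunu subr0 subrK.
have [Zu _] := mulmx1_unit ZZ.
have PZu : P *m (1%:M - nu) \in unitmx by rewrite unitmx_mul Pu.
exists (P *m (1%:M - nu)) => //.
apply: (canRL (mulmxK PZu)).
have DM : D *m M = D + nu by rewrite /nu mulmxBr mulmx1 DMD addrC subrK.
rewrite EPQ -/D -!mulmxA; congr (P *m _).
rewrite (mulmxA Q) -/M mulmxA DM mulmxBr mulmx1 [X in _ - X]mulmxDl Dnu nunu.
by rewrite addr0 addrK mulmxBl mul1mx nuD subr0.
Qed.

Lemma mxtrace_idempotent n (E : 'M[C]_n) :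
  E *m E = E -> \tr E = (\rank E)%:R.
Proof.
move=> /idempotent_conj_pid [P Pu EP]; rewrite {1}EP mxtrace_mulC mulmxA mulVmx //.
by rewrite mul1mx mxtrace_pid ?rank_leq_row.
Qed.

(** The matrix (A + mu) / (2 mu) is idempotent, and in characteristic zero its
    trace determines its rank. *)
Lemma semisimple_orbitP n k (mu : C) (A : 'M[C]_n) : (k <= n)%N -> mu != 0 ->
  semisimple_orbit k mu A <->
  A *m A = (mu ^+ 2)%:M /\ \tr A = (2 * k%:R - n%:R) * mu.
Proof.
move=> kn mu0.
have two_mu : 2 * mu != 0 by rewrite mulf_neq0 // Num.Theory.pnatr_eq0.
split=> [[P Pu ->]|[A2 trA]].
  have DD : (pid_mx k : 'M[C]_n) *m (pid_mx k : 'M[C]_n) = pid_mx k by rewrite pid_mx_id.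
  split.
    rewrite -!mulmxA (mulmxA (invmx P)) mulVmx // mul1mx !mulmxA.
    rewrite -(mulmxA P) two_eigenvalue_diagE.
    suff -> : ((2 * mu) *: pid_mx k - mu%:M) *m ((2 * mu) *: pid_mx k - mu%:M)
        = (mu ^+ 2)%:M :> 'M[C]_n.
      by rewrite scalar_mxC mulmxK.
    rewrite mulmxBl !mulmxBr -!scalemxAl -!scalemxAr !mul_scalar_mx !mul_mx_scalar DD.
    rewrite !scalerA -scalerBl scale_scalar_mx opprB addrA -addrAC -!scalerBl.
    rewrite (_ : _ - _ - _ = 0); last by ring.
    by rewrite scale0r add0r expr2.
  rewrite mxtrace_mulC mulmxA mulVmx // mul1mx two_eigenvalue_diagE.
  by rewrite raddfB /= mxtraceZ mxtrace_pid // mxtrace_scalar -mulr_natr; ring.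
pose E := (2 * mu)^-1 *: (A + mu%:M).
have AE : A = (2 * mu) *: E - mu%:M.
  by rewrite scalerA divff // scale1r addrK.
have EE : E *m E = E.
  rewrite /E -scalemxAl -scalemxAr; congr (_ *: _).
  have -> : (A + mu%:M) *m (A + mu%:M) = (2 * mu) *: (A + mu%:M).
    rewrite mulmxDl !mulmxDr A2 mul_mx_scalar !mul_scalar_mx expr2.
    rewrite -scale_scalar_mx -!scalerDr [mu%:M + A]addrC -mulr2n.
    by rewrite -scaler_nat scalerA mulrC.
  by rewrite scalerA mulVf // scale1r.
have rk : \rank E = k.
  apply/eqP; rewrite -(Num.Theory.eqr_nat C) -mxtrace_idempotent //.
  rewrite /E mxtraceZ raddfD /= trA mxtrace_scalar -mulr_natr.
  by apply/eqP; field; rewrite ?mu0 ?Num.Theory.pnatr_eq0.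
have [P Pu EP] := idempotent_conj_pid EE.
exists P => //; rewrite two_eigenvalue_diagE AE {1}EP rk.
by rewrite mulmxBr mulmxBl -scalemxAr -scalemxAl scalar_mxC mulmxK.
Qed.

(** If - mu is a simple eigenvalue, then mu - A is 2 mu times a projection of
    rank one. *)
Lemma semisimple_orbit_rank1 n (mu : C) (A : 'M[C]_n.+1) :
  semisimple_orbit n mu A ->
  exists (p : 'cV[C]_n.+1) (q : 'rV[C]_n.+1),
    mu%:M - A = p *m q /\ q *m p = (2 * mu)%:M.
Proof.
move=> [P Pu ->].
pose e : 'M[C]_(n.+1, 1) := delta_mx ord_max 0.
pose e' : 'M[C]_(1, n.+1) := delta_mx 0 ord_max.
have ee : mu%:M - two_eigenvalue_diag n.+1 n mu = (2 * mu) *: (e *m e').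
  apply/matrixP => i j; rewrite mul_delta_mx !mxE.
  rewrite -!(inj_eq val_inj) /=; case: (i =P j :> nat) => [<-|ne]; last first.
    rewrite !mulr0n subr0; case: eqP => [ei|]; last by rewrite mulr0.
    by case: eqP => [ej|]; [case: ne; rewrite ei ej | rewrite mulr0].
  rewrite !mulr1n andbb ltn_neqAle -ltnS ltn_ord andbT.
  by case: eqP => _ /=; ring.
exists ((2 * mu) *: (P *m e)), (e' *m invmx P); split; last first.
  rewrite -scalemxAr -!mulmxA (mulmxA (invmx P)) mulVmx // mul1mx mul_delta_mx.
  by apply/matrixP => i j; rewrite !ord1 !mxE eqxx mulr1.
rewrite -scalemxAl mulmxA -(mulmxA P e) scalemxAl scalemxAr -ee.
by rewrite mulmxBr mulmxBl scalar_mxC mulmxK.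
Qed.
End Orbit.

(** * Explicit matrices *)

Ltac entries := do !rewrite ?(mxE, big_ord_recl, big_ord0) /=.
Ltac trace_entries := rewrite /mxtrace; entries.
Ltac mx_entries :=
  apply/matrixP => -[[|[|[|[|//]]]] //= ?] [[|[|[|[|//]]]] //= ?]; entries.
(* Constants are tried first: a sum of constants is then closed at once. *)
Ltac regularity :=
  repeat first
    [ exact: regular_const | exact: regular_coord | exact: regular_lsubmx
    | exact: regular_rsubmx | exact: regular_mx_const
    | apply: regularD | apply: regularN | apply: regularM
    | apply: regular_mxD | apply: regular_mxN | apply: regular_mxM
    | apply: regular_rows_mx => -[|[|[|[|i]]]] -[|[|[|[|j]]]] //= _ _ ].

Section Explicit.
Variable C : fieldType.

Lemma rows_mx22E (M : 'M[C]_2) :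
  M = rows_mx 2 2 [:: [:: M 0 0; M 0 1]; [:: M 1 0; M 1 1]].
Proof.
by apply/matrixP => -[[|[|//]] i] -[[|[|//]] j]; rewrite !mxE /=;
   congr (M _ _); apply: val_inj.
Qed.

Lemma rows_mx21E (M : 'cV[C]_2) : M = rows_mx 2 1 [:: [:: M 0 0]; [:: M 1 0]].
Proof.
by apply/matrixP => -[[|[|//]] i] -[[|//] j]; rewrite !mxE /=;
   congr (M _ _); apply: val_inj.
Qed.

Lemma rows_mx12E (M : 'rV[C]_2) : M = rows_mx 1 2 [:: [:: M 0 0; M 0 1]].
Proof.
by apply/matrixP => -[[|//] i] -[[|[|//]] j]; rewrite !mxE /=;
   congr (M _ _); apply: val_inj.
Qed.

Lemma rows_mx13E (M : 'rV[C]_3) : M = rows_mx 1 3 [:: [:: M 0 0; M 0 1; M 0 2%:R]].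
Proof.
by apply/matrixP => -[[|//] i] -[[|[|[|//]]] j]; rewrite !mxE /=;
   congr (M _ _); apply: val_inj.
Qed.

Lemma companion_matrices2 (S : 'M[C]_2) : companion_matrices S ->
  exists s0 s1, S = rows_mx 2 2 [:: [:: 0; s0]; [:: 1; s1]].
Proof.
move=> hS; exists (S 0 ord_max), (S ord_max ord_max).
apply/matrixP => -[[|[|//]] i] -[[|[|//]] j]; rewrite !mxE /=;
  (by rewrite hS) || by congr (S _ _); apply: val_inj.
Qed.

Lemma companion_matrices3 (S : 'M[C]_3) : companion_matrices S ->
  exists s0 s1 s2, S = rows_mx 3 3 [:: [:: 0; 0; s0]; [:: 1; 0; s1]; [:: 0; 1; s2]].
Proof.
move=> hS; exists (S 0 ord_max), (S 1 ord_max), (S ord_max ord_max).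
apply/matrixP => -[[|[|[|//]]] i] -[[|[|[|//]]] j]; rewrite !mxE /=;
  (by rewrite hS) || by congr (S _ _); apply: val_inj.
Qed.

Lemma companion_matrices4 (S : 'M[C]_4) : companion_matrices S ->
  exists s0 s1 s2 s3, S = rows_mx 4 4
    [:: [:: 0; 0; 0; s0]; [:: 1; 0; 0; s1]; [:: 0; 1; 0; s2]; [:: 0; 0; 1; s3]].
Proof.
move=> hS; exists (S 0 ord_max), (S 1 ord_max), (S 2%:R ord_max), (S ord_max ord_max).
apply/matrixP => -[[|[|[|[|//]]]] i] -[[|[|[|[|//]]]] j]; rewrite !mxE /=;
  (by rewrite hS) || by congr (S _ _); apply: val_inj.
Qed.

(** * Matrices of rank two and lifted rank-one perturbations *)

(** A factorization through a plane is unique up to a change of basis.  When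
    G N J = 1, the products of N with J and of G with N give one such
    factorization, and (c1 c2), (d1 ; d2) is another: they differ by G (c1 c2),
    whose inverse is (d1 ; d2) J. *)
Lemma rank2_factorization n (N : 'M[C]_n) (c1 c2 : 'cV_n) (d1 d2 : 'rV_n)
    (G : 'M_(1 + 1, n)) (J : 'M_(n, 1 + 1)) :
  N = c1 *m d1 + c2 *m d2 -> G *m N *m J = 1%:M ->
  [/\ N = N *m J *m (G *m N),
      c1 = N *m J *m (G *m c1), c2 = N *m J *m (G *m c2),
      d1 = d1 *m J *m (G *m N)
    & d1 *m J *m (G *m c1) = 1%:M /\ d1 *m J *m (G *m c2) = 0].
Proof.
pose c : 'M_(n, 1 + 1) := row_mx c1 c2; pose d : 'M_(1 + 1, n) := col_mx d1 d2.
rewrite -mul_row_col -/c -/d => Ncd GNJ.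
have GcdJ : (G *m c) *m (d *m J) = 1%:M by rewrite !mulmxA -(mulmxA G) -Ncd.
have dJGc := mulmx1C GcdJ.
have cE : c = N *m J *m (G *m c).
  by rewrite Ncd -(mulmxA c) -mulmxA dJGc mulmx1.
have dE : d = d *m J *m (G *m N) by rewrite Ncd (mulmxA G) mulmxA dJGc mul1mx.
have NE : N = N *m J *m (G *m N) by rewrite {1}Ncd {1}dE mulmxA (mulmxA c) -Ncd.
move: cE; rewrite {2}/c mul_mx_row mul_mx_row => /eq_row_mx[c1E c2E].
move: dE; rewrite {2}/d !mul_col_mx => /eq_col_mx[d1E _].
move: dJGc; rewrite /c /d mul_mx_row mul_col_mx mul_col_row scalar_mx_block.
by case/eq_block_mx => e1 e2 _ _; split.
Qed.
End Explicit.

Section Lift.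
Variable C : numFieldType.

(** On the image of U the matrix U X V acts as X (V U) does on the plane, so that
    the equation of the orbit is a condition on matrices of size r. *)
Lemma semisimple_orbit_lift n r (mu : C)
    (U : 'M_(n.+1, r)) (V : 'M_(r, n.+1)) (X : 'M_r) :
  mu != 0 -> X *m (V *m U) *m X = - (2 * mu) *: X ->
  \tr (X *m (V *m U)) = - (2 * mu) ->
  semisimple_orbit n mu (mu%:M + U *m X *m V).
Proof.
move=> mu0 XHX trXH; apply/semisimple_orbitP => //; split; last first.
  rewrite raddfD /= mxtrace_scalar mxtrace_mulC mulmxA mxtrace_mulC trXH.
  by rewrite -mulr_natr -natr1; ring.
have M2 : U *m X *m V *m (U *m X *m V) = - (2 * mu) *: (U *m X *m V).
  by rewrite scalemxAl scalemxAr -XHX !mulmxA.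
rewrite mulmxDl !mulmxDr M2 !mul_scalar_mx mul_mx_scalar scale_scalar_mx -expr2.
rewrite -addrA -!scalerDl (_ : mu + (mu + - (2 * mu)) = 0); last by ring.
by rewrite scale0r addr0.
Qed.
End Lift.

(** * The slice for n = 2 *)

Section Companion2.
Variable C : fieldType.

(** Multiplication by l on C[l] / (l^2 - x), in the basis 1, l. *)
Definition companion2 (x : C) : 'M[C]_2 :=
  rows_mx 2 2 [:: [:: 0; x]; [:: 1; 0]].
End Companion2.

Section D21.
Variable C : numFieldType.
Variables mu1 mu2 : C.
Hypotheses (mu1_neq0 : mu1 != 0) (mu2_neq0 : mu2 != 0).

(** The general matrix A of trace 0 for which A L + L A is the scalar
    x + mu1^2 - mu2^2, where L = companion2 x; this scalar is what makes A^2 and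
    (L - A)^2 differ by mu1^2 - mu2^2. *)
Definition A_D21 (a c x : C) := rows_mx 2 2
   [:: [:: a; x / 2 - x * c + (mu1 ^+ 2 - mu2 ^+ 2)]; [:: c + 1 / 2; - a]].

Lemma D21_of_surface (a c x : C) :
  a ^+ 2 - x * c ^+ 2 + 1 / 4 * x + (mu1 ^+ 2 - mu2 ^+ 2) * c
    - 1 / 2 * (mu1 ^+ 2 + mu2 ^+ 2) = 0 ->
  slodowy_pairs 1 1 mu1 mu2 (A_D21 a c x, companion2 x - A_D21 a c x).
Proof.
move=> F0.
split=> /=; last first.
- by move=> -[[|[|//]] i] -[[|//] j] _; rewrite !mxE /=; ring.
- apply/semisimple_orbitP => //; split.
    by mx_entries; (by field) || (by apply: subr0_eq; rewrite -[RHS]F0; field).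
  by trace_entries; ring.
- apply/semisimple_orbitP => //; split.
    by mx_entries; (by field) || (by apply: subr0_eq; rewrite -[RHS]F0; field).
  by trace_entries; ring.
Qed.

Lemma surface_of_D21 A B : slodowy_pairs 1 1 mu1 mu2 (A, B) ->
  exists a c x, a ^+ 2 - x * c ^+ 2 + 1 / 4 * x + (mu1 ^+ 2 - mu2 ^+ 2) * c
             - 1 / 2 * (mu1 ^+ 2 + mu2 ^+ 2) = 0 /\
    A = A_D21 a c x /\ B = companion2 x - A_D21 a c x.
Proof.
move=> [/= /semisimple_orbitP [] // A2 trA /semisimple_orbitP [] // B2 trB].
move=> /companion_matrices2 [x [s1 AB]].
have BE : B = rows_mx 2 2 [:: [:: 0; x]; [:: 1; s1]] - A.
  by rewrite -AB addrAC subrr add0r.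
move: AB => _; subst B.
move: A2 trA B2 trB; rewrite (rows_mx22E A).
move: (A 0 0) (A 0 1) (A 1 0) (A 1 1) => a b c d {A}.
move=> /matrixP /(_ 0 0); entries => A2.
trace_entries => trA.
move=> /matrixP /(_ 0 0); entries => B2.
trace_entries => trB.
have dE : d = - a by apply: (eq_by_multiple 1 trA); ring.
subst d.
have s1E : s1 = 0 by apply: (eq_by_multiple 1 trB); ring.
subst s1.
have bE : b = x / 2 - x * (c - 1 / 2) + (mu1 ^+ 2 - mu2 ^+ 2).
  by apply: (eq_by_multiple 1 (f_equal2 (fun u v => u - v) A2 B2)); field.
exists a, (c - 1 / 2), x; split.
  apply: (eq_by_multiple (1 / 2) (f_equal2 (fun u v => u + v) A2 B2)).
  by rewrite bE; field.
by rewrite /companion2 /A_D21 -bE subrK.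
Qed.

Lemma D21_isomorphic : affine_isomorphic (D21 mu1 mu2)
        (zero_locus3 (fun a c x : C =>
           a ^+ 2 - x * c ^+ 2 + 1 / 4 * x + (mu1 ^+ 2 - mu2 ^+ 2) * c
             - 1 / 2 * (mu1 ^+ 2 + mu2 ^+ 2))).
Proof.
pose gA (v : 'rV_3) := A_D21 (v 0 0) (v 0 1) (v 0 2%:R).
apply: (@slodowy_isomorphic _ _ _ _ _ _ _ _ gA (fun v => companion2 (v 0 2%:R) - gA v)
   (fun A B => rows_mx 1 3 [:: [:: A 0 0; A 1 0 - 1 / 2; A 0 1 + B 0 1]])).
- by rewrite /gA /A_D21; regularity.
- by rewrite /gA /A_D21 /companion2; regularity.
- by regularity.
- move=> v; rewrite [RHS]rows_mx13E !mxE /=; congr rows_mx.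
  by congr [:: [:: _; _; _]]; ring.
- by move=> v; apply: D21_of_surface.
- move=> A B /surface_of_D21 [a [c [x [F0 [-> ->]]]]].
  by exists (rows_mx 1 3 [:: [:: a; c; x]]); rewrite /zero_locus3 /gA /= !mxE.
Qed.
End D21.

(** * The slice for n = 3 *)

Section D11.
Variable C : numFieldType.
Variables mu1 mu2 : C.
Hypotheses (mu1_neq0 : mu1 != 0) (mu2_neq0 : mu2 != 0).
Let s := mu1 + mu2.

(** With h = l - s and sigma = h (l^2 - x): multiplication by h from
    C[l] / (l^2 - x) to C[l] / sigma, reduction in the other direction, and
    multiplication by l on C[l] / sigma, in the bases of powers of l. *)
Definition U_D11 := rows_mx 3 2 [:: [:: - s; 0]; [:: 1; - s]; [:: 0; 1]].
Definition V_D11 (x : C) := rows_mx 2 3 [:: [:: 1; 0; x]; [:: 0; 1; 0]].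
Definition S_D11 (x : C) := rows_mx 3 3
  [:: [:: 0; 0; - s * x]; [:: 1; 0; x]; [:: 0; 1; s]].
(** Division by h of the multiples of h, which is a left inverse of U, and the
    inclusion of the polynomials of degree less than 2. *)
Definition G_D11 := rows_mx 2 3 [:: [:: 0; 1; s]; [:: 0; 0; 1]].
Definition J_D11 : 'M[C]_(3, 2) := rows_mx 3 2 [:: [:: 1; 0]; [:: 0; 1]; [:: 0; 0]].
(** The matrices of trace 1 whose product with companion2 x has trace
    mu2 - mu1; the determinant is the left side of the surface equation. *)
Definition X_D11 (x y z : C) := rows_mx 2 2
  [:: [:: 1 / 2 + z; mu2 - mu1 - x * y]; [:: y; 1 / 2 - z]].
Definition A_D11 (x y z : C) := mu1%:M + U_D11 *m X_D11 x y z *m V_D11 x.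

Lemma mulUV_D11 x : U_D11 *m V_D11 x = S_D11 x - s%:M.
Proof. by mx_entries; ring. Qed.

Lemma mulVU_D11 x : V_D11 x *m U_D11 = companion2 x - s%:M.
Proof. by mx_entries; ring. Qed.

Lemma mulGU_D11 : G_D11 *m U_D11 = 1%:M.
Proof. by mx_entries; ring. Qed.

(** When det X = 0, both X and 1 - X are projections onto a line, and the lifts
    of these two complementary projections give A and B. *)
Lemma D11_of_surface (x y z : C) :
  y ^+ 2 * x - z ^+ 2 + 1 / 4 + (mu1 - mu2) * y = 0 ->
  slodowy_pairs 2 2 mu1 mu2 (A_D11 x y z, S_D11 x - A_D11 x y z).
Proof.
move=> F0; split=> /=.
- apply: semisimple_orbit_lift => //; rewrite mulVU_D11.
    (* Cayley-Hamilton for X and for L X, with L = companion2 x: the two sides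
       differ by det X (s - adj L). *)
    by mx_entries; [apply: (eq_by_multiple s F0)|apply: (eq_by_multiple x F0)
       |apply: (eq_by_multiple 1 F0)|apply: (eq_by_multiple s F0)]; rewrite /s; field.
  by trace_entries; rewrite /s; field.
- have -> : S_D11 x - A_D11 x y z = mu2%:M + U_D11 *m (1%:M - X_D11 x y z) *m V_D11 x.
    rewrite mulmxBr mulmxBl mulmx1 mulUV_D11 /A_D11 opprD !addrA; congr (_ - _).
    rewrite (_ : s%:M = mu1%:M + mu2%:M :> 'M_3); last by rewrite /s raddfD.
    by rewrite [mu2%:M + S_D11 x]addrC -addrA opprD [mu2%:M + (_ - _)]addrCA subrr addr0.
  apply: semisimple_orbit_lift => //; rewrite mulVU_D11.
    by mx_entries; [apply: (eq_by_multiple s F0)|apply: (eq_by_multiple x F0)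
       |apply: (eq_by_multiple 1 F0)|apply: (eq_by_multiple s F0)]; rewrite /s; field.
  by trace_entries; rewrite /s; field.
- rewrite addrC subrK => i -[[|[|//]] j] // _;
  case: i => -[|[|[|//]]] i; by entries.
Qed.

(** The rank-one matrices mu1 - A and mu2 - B add up to s - S, which has rank two.
    This forces h to divide the characteristic polynomial of S, and it makes the
    two matrices lifts of 2 x 2 matrices of rank one. *)
Lemma surface_of_D11 A B : slodowy_pairs 2 2 mu1 mu2 (A, B) ->
  exists x y z, y ^+ 2 * x - z ^+ 2 + 1 / 4 + (mu1 - mu2) * y = 0 /\
    A = A_D11 x y z /\ B = S_D11 x - A_D11 x y z.
Proof.
move=> [/= hA hB hS].
have /semisimple_orbitP[//|//|_ trA] := hA; have /semisimple_orbitP[//|//|_ trB] := hB.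
have [p1 [q1 [pq1 qp1]]] := semisimple_orbit_rank1 hA.
have [p2 [q2 [pq2 _]]] := semisimple_orbit_rank1 hB.
have [s0 [x [s2 SE]]] := companion_matrices3 hS.
have s2E : s2 = s.
  have : \tr (A + B) = (2 * 2 - 3) * mu1 + (2 * 2 - 3) * mu2 by rewrite raddfD /= trA trB.
  rewrite SE; trace_entries => tr.
  by apply: (eq_by_multiple 1 tr); rewrite /s; ring.
subst s2.
set S := rows_mx _ _ _ in SE.
have NE : S - s%:M = p1 *m (- q1) + p2 *m (- q2).
  rewrite !mulmxN -pq1 -pq2 -SE !opprB addrACA; congr (_ + _).
  by rewrite /s raddfD /= opprD.
have NJ : (S - s%:M) *m J_D11 = U_D11 by mx_entries; ring.
have GNJ : G_D11 *m (S - s%:M) *m J_D11 = 1%:M by rewrite -mulmxA NJ mulGU_D11.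
have [N3 p1E _ q1E [qp11 _]] := rank2_factorization NE GNJ.
have s0E : s0 = - s * x.
  move: N3; rewrite NJ => /matrixP /(_ 0 2%:R); entries => e.
  by apply: (eq_by_multiple 1 e); ring.
have SE' : S = S_D11 x by rewrite /S s0E.
move: p1E q1E qp11; rewrite NJ SE' -mulUV_D11 (mulmxA G_D11) mulGU_D11 mul1mx !mulNmx.
set a := G_D11 *m p1; set b := q1 *m J_D11 => p1E /oppr_inj q1E ba.
have bHa : b *m (companion2 x - s%:M) *m a = (2 * mu1)%:M.
  by rewrite -mulVU_D11 -qp1 p1E {1}q1E !mulmxA.
have AE : A = mu1%:M - U_D11 *m (a *m b) *m V_D11 x.
  by rewrite mulmxA -mulmxA -p1E -q1E -pq1 opprB addrC subrK.
have BE : B = S_D11 x - A by rewrite -SE' -SE addrC addKr.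
move: ba bHa AE; rewrite (rows_mx21E a) (rows_mx12E b).
move: (a 0 0) (a 1 0) (b 0 0) (b 0 1) => a0 a1 b0 b1.
move=> /matrixP /(_ 0 0); entries => ba /matrixP /(_ 0 0); entries => bHa AE.
have bLa : b1 * a0 + x * (b0 * a1) = mu1 - mu2.
  apply: (eq_by_multiple 1 (f_equal2 (fun u v => u - s * v) bHa ba)).
  by rewrite /s; ring.
have XE : X_D11 x (- (a1 * b0)) (- (a0 * b0) - 1 / 2)
  = - (rows_mx 2 1 [:: [:: a0]; [:: a1]] *m rows_mx 1 2 [:: [:: b0; b1]]).
  mx_entries; [by field | by apply: (eq_by_multiple 1 bLa); ring | by ring |].
  by apply: (eq_by_multiple (- 1) ba); field.
have AE' : A = A_D11 x (- (a1 * b0)) (- (a0 * b0) - 1 / 2).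
  by rewrite /A_D11 XE mulmxN mulNmx.
exists x, (- (a1 * b0)), (- (a0 * b0) - 1 / 2); split; last by rewrite BE -AE'.
apply: (eq_by_multiple 1
  (f_equal2 (fun u v => a1 * b0 * u + a0 * b0 * v) bLa ba)).
by field.
Qed.

Lemma D11_isomorphic : affine_isomorphic (D11 mu1 mu2)
        (zero_locus3 (fun x y z : C =>
           y ^+ 2 * x - z ^+ 2 + 1 / 4 + (mu1 - mu2) * y)).
Proof.
pose gA (v : 'rV_3) := A_D11 (v 0 0) (v 0 1) (v 0 2%:R).
apply: (@slodowy_isomorphic _ _ _ _ _ _ _ _ gA (fun v => S_D11 (v 0 0) - gA v)
   (fun A B => rows_mx 1 3 [:: [:: A 1 2%:R + B 1 2%:R; A 2%:R 0; 1 / 2 - A 2%:R 1]])).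
- by rewrite /gA /A_D11 /X_D11 /V_D11; regularity.
- by rewrite /gA /A_D11 /S_D11 /X_D11 /V_D11; regularity.
- by regularity.
- move=> v; rewrite [RHS]rows_mx13E /gA; congr rows_mx.
  move: (v 0 0) (v 0 1) (v 0 2%:R) => x y z.
  by congr [:: [:: _; _; _]]; entries; ring.
- by move=> v; apply: D11_of_surface.
- move=> A B /surface_of_D11 [x [y [z [F0 [-> ->]]]]].
  by exists (rows_mx 1 3 [:: [:: x; y; z]]); rewrite /zero_locus3 /gA /= !mxE.
Qed.
End D11.

(** * The slice for n = 4 *)

Section D01.
Variable C : numFieldType.
Variables mu1 mu2 : C.
Hypotheses (mu1_neq0 : mu1 != 0) (mu2_neq0 : mu2 != 0).
Let kappa := mu1 ^+ 2 - mu2 ^+ 2.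

(** The analogues of the matrices for n = 3, now with
    h = (l - mu1)^2 - mu2^2 and sigma = h (l^2 - x). *)
Definition U_D01 := rows_mx 4 2
  [:: [:: kappa; 0]; [:: - (2 * mu1); kappa]; [:: 1; - (2 * mu1)]; [:: 0; 1]].
Definition V_D01 (x : C) := rows_mx 2 4 [:: [:: 1; 0; x; 0]; [:: 0; 1; 0; x]].
Definition S_D01 (x : C) := rows_mx 4 4
  [:: [:: 0; 0; 0; kappa * x]; [:: 1; 0; 0; - (2 * mu1) * x];
      [:: 0; 1; 0; x - kappa]; [:: 0; 0; 1; 2 * mu1]].
Definition G_D01 := rows_mx 2 4 [:: [:: 0; 0; 1; 2 * mu1]; [:: 0; 0; 0; 1]].
Definition J_D01 : 'M[C]_(4, 2) :=
  rows_mx 4 2 [:: [:: 1; 0]; [:: 0; 1]; [:: 0; 0]; [:: 0; 0]].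
(** The matrices of trace 0 whose product with companion2 x has trace 1; the
    determinant is the opposite of the left side of the surface equation. *)
Definition X_D01 (t w x : C) := rows_mx 2 2 [:: [:: t; 1 - x * w]; [:: w; - t]].
Definition A_D01 (t w x : C) := mu1%:M + U_D01 *m X_D01 t w x *m V_D01 x.

Lemma companion_quadratic (s0 s1 s2 : C) :
  let T := rows_mx 4 4 [:: [:: 0; 0; 0; s0]; [:: 1; 0; 0; s1]; [:: 0; 1; 0; s2];
    [:: 0; 0; 1; 2 * mu1]] - mu1%:M in
  T *m T - (mu2 ^+ 2)%:M =
  rows_mx 4 4 [:: [:: kappa; 0; s0; 0]; [:: - (2 * mu1); kappa; s1; s0];
    [:: 1; - (2 * mu1); kappa + s2; s1]; [:: 0; 1; 0; kappa + s2]].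
Proof. by move=> T; rewrite /T; mx_entries; rewrite /kappa; ring. Qed.
(** This is h(S) = U V. *)
Lemma mulUV_D01 x : U_D01 *m V_D01 x =
  (S_D01 x - mu1%:M) *m (S_D01 x - mu1%:M) - (mu2 ^+ 2)%:M.
Proof. by rewrite companion_quadratic; mx_entries; ring. Qed.

Lemma mulVU_D01 x : V_D01 x *m U_D01 = (x + kappa)%:M - (2 * mu1) *: companion2 x.
Proof. by mx_entries; rewrite /kappa; ring. Qed.

Lemma mulGU_D01 : G_D01 *m U_D01 = 1%:M.
Proof. by mx_entries; rewrite /kappa; ring. Qed.

Lemma mulSU_D01 x : (S_D01 x - mu1%:M) *m U_D01 = U_D01 *m (companion2 x - mu1%:M).
Proof. by mx_entries; rewrite /kappa; ring. Qed.

Lemma mulVS_D01 x : V_D01 x *m (S_D01 x - mu1%:M) = (companion2 x - mu1%:M) *m V_D01 x.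
Proof. by mx_entries; rewrite /kappa; ring. Qed.

(** B = T - U X V with T = S - mu1, and T^2 = mu2^2 + U V.  The other terms of B^2
    cancel U V exactly when L X + X L = 1 - 2 mu1 X, with L = companion2 x - mu1,
    which says that X has trace 0 and trace 1 against companion2 x. *)
Lemma D01_of_surface (t w x : C) : t ^+ 2 - x * w ^+ 2 + w = 0 ->
  slodowy_pairs 3 2 mu1 mu2 (A_D01 t w x, S_D01 x - A_D01 t w x).
Proof.
move=> F0.
set X := X_D01 t w x; set L := companion2 x - mu1%:M; set T := S_D01 x - mu1%:M.
set U := U_D01; set V := V_D01 x.
have XHX : X *m (V *m U) *m X = - (2 * mu1) *: X.
  rewrite mulVU_D01 /X.
  (* Cayley-Hamilton: X^2 = - det X, and X N X = X + det X N for
     N = companion2 x. *)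
  by mx_entries; [apply: (eq_by_multiple (x + kappa) F0)
    |apply: (eq_by_multiple (2 * mu1 * x) F0)|apply: (eq_by_multiple (2 * mu1) F0)
    |apply: (eq_by_multiple (x + kappa) F0)]; rewrite /kappa; ring.
have LX : L *m X + X *m L = 1%:M - (2 * mu1) *: X.
  by rewrite /L; mx_entries; ring.
have hA : semisimple_orbit 3 mu1 (A_D01 t w x).
  apply: semisimple_orbit_lift => //; rewrite mulVU_D01.
  by trace_entries; ring.
split=> //=; last first.
- rewrite addrC subrK => i -[[|[|[|//]]] j] // _;
  case: i => -[|[|[|[|//]]]] i; by entries.
apply/semisimple_orbitP => //; split; last first.
  have /semisimple_orbitP[//|//|_ trA] := hA.
  by rewrite raddfB /= trA; trace_entries; ring.
have -> : S_D01 x - A_D01 t w x = T - U *m X *m V by rewrite /A_D01 opprD addrA.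
have TM : T *m (U *m X *m V) = U *m (L *m X) *m V by rewrite !mulmxA mulSU_D01.
have MT : U *m X *m V *m T = U *m (X *m L) *m V.
  by rewrite -!mulmxA mulVS_D01.
have MM : U *m X *m V *m (U *m X *m V) = - (2 * mu1) *: (U *m X *m V).
  by rewrite scalemxAl scalemxAr -XHX !mulmxA.
have TT : T *m T = (mu2 ^+ 2)%:M + U *m V by rewrite mulUV_D01 addrC subrK.
(* With bodies, T and L would be split as differences by the rewriting below. *)
clearbody T L.
rewrite mulmxBl !mulmxBr TM MT MM TT opprB [_ *: _ - _]addrC addrA.
rewrite -[_ - _ - _]addrA -opprD.
rewrite -mulmxDl -mulmxDr LX mulmxBr mulmxBl mulmx1.
rewrite -scalemxAr -scalemxAl scaleNr opprB.
by rewrite [_ - U *m V]addrC addrA addrK addrK.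
Qed.

(** With mu1 - A = p q and T = S - mu1, the equation (T + p q)^2 = mu2^2 expresses
    T^2 - mu2^2 through the two columns T p, p and two rows, the first of them
    - q.  It has therefore rank two, which forces S to have characteristic
    polynomial h (l^2 - x), and p q is a lift. *)
Lemma surface_of_D01 A B : slodowy_pairs 3 2 mu1 mu2 (A, B) ->
  exists t w x, t ^+ 2 - x * w ^+ 2 + w = 0 /\
    A = A_D01 t w x /\ B = S_D01 x - A_D01 t w x.
Proof.
move=> [/= hA hB hS].
have /semisimple_orbitP[//|//|_ trA] := hA; have /semisimple_orbitP[//|//|B2 trB] := hB.
have [p [q [pq qp]]] := semisimple_orbit_rank1 hA.
have [s0 [s1 [s2 [s3 SE]]]] := companion_matrices4 hS.
have s3E : s3 = 2 * mu1.
  have : \tr (A + B) = (2 * 3 - 4) * mu1 + (2 * 2 - 4) * mu2 by rewrite raddfD /= trA trB.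
  rewrite SE; trace_entries => tr.
  by apply: (eq_by_multiple 1 tr); ring.
subst s3.
set S := rows_mx _ _ _ in SE; set T := S - mu1%:M; set N := T *m T - (mu2 ^+ 2)%:M.
have NE : N = (T *m p) *m (- q) + p *m (- (q *m T + (2 * mu1) *: q)).
  have BT : B = T + p *m q by rewrite -pq /T -SE addrA subrK addrAC subrr add0r.
  have MM : p *m q *m (p *m q) = (2 * mu1) *: (p *m q).
    by rewrite -mulmxA (mulmxA q) qp mul_scalar_mx scalemxAr.
  rewrite /N -B2 BT; clearbody T.
  rewrite mulmxDl !mulmxDr MM !mulmxN mulmxDr -scalemxAr !mulmxA.
  by rewrite -addrA opprD addNKr opprD.
have NE' : N = _ := companion_quadratic s0 s1 s2.
have NJ : N *m J_D01 = U_D01 by rewrite NE'; mx_entries; ring.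
have GNJ : G_D01 *m N *m J_D01 = 1%:M by rewrite -mulmxA NJ mulGU_D01.
have [N3 _ pE qE [qTp qp0]] := rank2_factorization NE GNJ.
pose x := s2 + kappa.
have SE' : S = S_D01 x.
  have s0E : s0 = kappa * x.
    move: N3; rewrite NJ NE' => /matrixP /(_ 0 2%:R); entries => e.
    by apply: (eq_by_multiple 1 e); rewrite /x /kappa; ring.
  have s1E : s1 = - (2 * mu1) * x.
    move: N3; rewrite NJ NE' => /matrixP /(_ 1 2%:R); entries => e.
    by apply: (eq_by_multiple 1 e); rewrite /x /kappa; ring.
  by rewrite /S s0E s1E /S_D01 /x addrK.
have NUV : N = U_D01 *m V_D01 x by rewrite mulUV_D01 -SE'.
move: pE qE qTp qp0.
rewrite NJ NUV [G_D01 *m (U_D01 *m _)]mulmxA mulGU_D01 mul1mx !mulNmx.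
set a := G_D01 *m p; set b := q *m J_D01 => pE /oppr_inj qE qTp /eqP.
rewrite oppr_eq0 => /eqP ba0.
have bLa : - (b *m (companion2 x - mu1%:M) *m a) = 1%:M.
  rewrite -qTp {1}pE (mulmxA T) {1}/T SE' mulSU_D01 !mulmxA -(mulmxA b G_D01).
  by rewrite mulGU_D01 mulmx1.
have AE : A = mu1%:M - U_D01 *m (a *m b) *m V_D01 x.
  by rewrite mulmxA -mulmxA -pE -qE -pq opprB addrC subrK.
have BE : B = S_D01 x - A by rewrite -SE' -SE addrC addKr.
move: ba0 bLa AE; rewrite (rows_mx21E a) (rows_mx12E b).
move: (a 0 0) (a 1 0) (b 0 0) (b 0 1) => a0 a1 b0 b1.
move=> /matrixP /(_ 0 0); entries => ba /matrixP /(_ 0 0); entries => bHa AE.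
have bLa : b1 * a0 + x * (b0 * a1) = - 1.
  by apply: (eq_by_multiple (- 1) (f_equal2 (fun u v => v - mu1 * u) ba bHa)); ring.
have XE : X_D01 (- (a0 * b0)) (- (a1 * b0)) x
  = - (rows_mx 2 1 [:: [:: a0]; [:: a1]] *m rows_mx 1 2 [:: [:: b0; b1]]).
  mx_entries; [by ring | by apply: (eq_by_multiple 1 bLa); ring | by ring |].
  by apply: (eq_by_multiple 1 ba); ring.
have AE' : A = A_D01 (- (a0 * b0)) (- (a1 * b0)) x.
  by rewrite /A_D01 XE mulmxN mulNmx.
exists (- (a0 * b0)), (- (a1 * b0)), x; split; last by rewrite BE -AE'.
apply: (eq_by_multiple 1 (f_equal2 (fun u v => a0 * b0 * u - a1 * b0 * v) ba bLa)).
by ring.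
Qed.

Lemma D01_isomorphic : affine_isomorphic (D01 mu1 mu2)
  (zero_locus3 (fun t w x : C => t ^+ 2 - x * w ^+ 2 + w)).
Proof.
pose gA (v : 'rV_3) := A_D01 (v 0 0) (v 0 1) (v 0 2%:R).
apply: (@slodowy_isomorphic _ _ _ _ _ _ _ _ gA (fun v => S_D01 (v 0 2%:R) - gA v)
   (fun A B => rows_mx 1 3
      [:: [:: - A 3%:R 1; A 3%:R 0; A 2%:R 3%:R + B 2%:R 3%:R + kappa]])).
- by rewrite /gA /A_D01 /X_D01 /V_D01; regularity.
- by rewrite /gA /A_D01 /S_D01 /X_D01 /V_D01; regularity.
- by regularity.
- move=> v; rewrite [RHS]rows_mx13E /gA; congr rows_mx.
  move: (v 0 0) (v 0 1) (v 0 2%:R) => t w x.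
  by congr [:: [:: _; _; _]]; entries; ring.
- by move=> v; apply: D01_of_surface.
- move=> A B /surface_of_D01 [t [w [x [F0 [-> ->]]]]].
  by exists (rows_mx 1 3 [:: [:: t; w; x]]); rewrite /zero_locus3 /gA /= !mxE.
Qed.
End D01.

(** * The three isomorphisms *)

Theorem mainTheorem9 (R : realType) (mu1 mu2 : R[i])
    (hmu1 : mu1 != 0) (hmu2 : mu2 != 0) :
  [/\ affine_isomorphic (D21 mu1 mu2)
        (zero_locus3 (fun a c x : R[i] =>
           a ^+ 2 - x * c ^+ 2 + 1 / 4 * x + (mu1 ^+ 2 - mu2 ^+ 2) * c
             - 1 / 2 * (mu1 ^+ 2 + mu2 ^+ 2))),
      affine_isomorphic (D11 mu1 mu2)
        (zero_locus3 (fun x y z : R[i] =>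
           y ^+ 2 * x - z ^+ 2 + 1 / 4 + (mu1 - mu2) * y))
    & affine_isomorphic (D01 mu1 mu2)
        (zero_locus3 (fun t w x : R[i] =>
           t ^+ 2 - x * w ^+ 2 + w))].
Proof.
split; [exact: D21_isomorphic | exact: D11_isomorphic | exact: D01_isomorphic].
Qed.
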